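(* Let $\widehat{H}$ be a finite weakly balanced reflexive signed graph with no purely red edges, and let $\le$ be a special min ordering of $\widehat H$. Let $\widehat G$ be a signed graph, let $C$ be a closed walk in $\widehat{G}$, and let $f, f'$ be two homomorphisms of $\widehat{G}$ to $\widehat{H}$ such that $f(v) \leq f'(v)$ for all vertices $v$ of $\widehat{G}$, and such that the image $f(C)$ contains only blue edges while the image $f'(C)$ contains a bicoloured edge. Then the homomorphic images $f(C)$ and $f'(C)$ are disjoint (have no common vertex).
   Context: A signed graph is a graph (loops allowed) whose edges each carry the sign $+$ (blue), $-$ (red), or both (bicoloured); an edge with exactly one sign is unicoloured. $\widehat H$ is reflexive (every vertex has a loop), weakly balanced, and has no purely red edges, so its unicoloured edges are blue. $H$ denotes its underlying graph. A homomorphism of a signed graph $\widehat G$ to $\widehat H$ is a homomorphism $f$ of the underlying graphs mapping bicoloured edges to bicoloured edges such that every closed walk $W$ of unicoloured edges of $\widehat G$ whose image $f(W)$ consists of unicoloured edges has the same parity of the number of red edges as $f(W)$. A min ordering of a reflexive graph $H$ is a linear order $<$ of $V(H)$ such that whenever $uv, u'v' \in E(H)$ with $u<u'$ and $v'<v$, also $uv' \in E(H)$. A special min ordering of $\widehat H$ is a min ordering of $H$ such that at each vertex, every neighbour joined to it by a bicoloured edge precedes every neighbour joined to it by a unicoloured edge. *)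

(* Defs.v *)
From mathcomp Require Import all_boot.
Set Implicit Arguments.
Unset Strict Implicit.
Unset Printing Implicit Defensive.

(* [pos G u v] (resp. [neg G u v]): there is an edge uv and its sign set
   contains + (resp. -); both hold exactly for bicoloured edges. *)
Record sgraph (V : Type) := SGraph {
  pos : rel V;
  neg : rel V;
  pos_sym : symmetric pos;
  neg_sym : symmetric neg
}.

Section SignedGraph.
Variables (V : Type) (G : sgraph V).

Definition adj : rel V := fun u v => pos G u v || neg G u v.
Definition blue : rel V := fun u v => pos G u v && ~~ neg G u v.
Definition red : rel V := fun u v => neg G u v && ~~ pos G u v.
Definition bicoloured : rel V := fun u v => pos G u v && neg G u v.
Definition unicoloured : rel V := fun u v => blue u v || red u v.

Definition reflexive_sgraph : Prop := reflexive adj.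
Definition no_red : Prop := forall u v, ~~ red u v.

End SignedGraph.

(* A walk is a start vertex [x] and the sequence [p] of the later vertices. *)
Definition walk_edges (V : Type) (x : V) (p : seq V) : seq (V * V) :=
  zip (x :: p) p.

Definition closed_walk (V : Type) (e : rel V) (x : V) (p : seq V) : Prop :=
  path e x p /\ last x p = x.

Definition num_red (V : Type) (G : sgraph V) (x : V) (p : seq V) : nat :=
  count (fun uv => red G uv.1 uv.2) (walk_edges x p).

Definition weakly_balanced (V : Type) (G : sgraph V) : Prop :=
  forall x p, closed_walk (unicoloured G) x p -> ~~ odd (num_red G x p).

Definition sgraph_hom (V W : Type) (G : sgraph V) (H : sgraph W)
    (f : V -> W) : Prop :=
  [/\ forall u v, adj G u v -> adj H (f u) (f v),
      forall u v, bicoloured G u v -> bicoloured H (f u) (f v)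
    & forall x p, closed_walk (unicoloured G) x p ->
        path (unicoloured H) (f x) (map f p) ->
        odd (num_red G x p) = odd (num_red H (f x) (map f p))].

Definition linear_order (V : eqType) (le : rel V) : Prop :=
  [/\ reflexive le, antisymmetric le, transitive le & total le].

Definition strict (V : eqType) (le : rel V) : rel V :=
  fun u v => (u != v) && le u v.

Definition min_ordering (V : eqType) (e le : rel V) : Prop :=
  linear_order le /\
  forall u v u' v', e u v -> e u' v' -> strict le u u' -> strict le v' v ->
    e u v'.

Definition special_min_ordering (V : eqType) (H : sgraph V) (le : rel V) :
    Prop :=
  min_ordering (adj H) le /\
  forall v a b, bicoloured H v a -> unicoloured H v b -> strict le a b.

(* Main.v *)
Require Import Defs.
From mathcomp Require Import all_boot.

Set Implicit Arguments.
Unset Strict Implicit.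

(** In a reflexive graph a min ordering makes the later neighbours of a vertex
an interval starting at that vertex, and the special condition makes every edge
from a vertex [c] with a bicoloured loop to an earlier vertex bicoloured.  Say
that [a] lies before [c] if [a < c] and [a], [c] are not adjacent; for such a
[c], this property is shared by the two ends of a blue edge.  Call a vertex [v]
of the walk separated if some [c <= f' v] with a bicoloured loop has [f v]
before it.  The lower end of a bicoloured edge of [f'(C)] is a witness [c], and
separation propagates along the walk: when [f'] steps from above [c] to a vertex
below it, that vertex is itself a new witness.  Hence every vertex of [f'(C)] is
at or above a witness, while all of [f(C)] is strictly below it. *)

Lemma all_walk_edges {T : Type} (e : rel T) (x : T) (p : seq T) :
  all (fun uv => e uv.1 uv.2) (walk_edges x p) = path e x p.
Proof. by elim: p x => [|y p IHp] x //=; rewrite -IHp. Qed.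

Lemma has_walk_edges_map {T U : Type} {e : rel T} {r : rel U} {g : T -> U}
    {Q : pred T} {x : T} {p : seq T} :
  (forall u v, e u v -> r (g u) (g v) -> Q u || Q v) -> path e x p ->
  has (fun uv => r uv.1 uv.2) (walk_edges (g x) (map g p)) -> has Q (x :: p).
Proof.
move=> eQ; elim: p x => [|y p IHp] x //= /andP[exy yp] /orP[rxy|ryp].
  by have := eQ _ _ exy rxy; rewrite orbA => ->.
by have /= -> := IHp y yp ryp; rewrite orbT.
Qed.

(** Since [Q] agrees at both ends of every edge, it spreads forwards and backwards from any vertex
    of the path. *)
Lemma path_invariant_all {T : Type} {e : rel T} {Q : pred T} {x : T}
    {p : seq T} :
  (forall u v, e u v -> Q u = Q v) -> path e x p ->
  has Q (x :: p) -> all Q (x :: p).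
Proof.
move=> eQ xp; suff [-> ->] : has Q (x :: p) = Q x /\ all Q (x :: p) = Q x by [].
elim: p x xp => [|y p IHp] x /=; first by rewrite orbF andbT.
case/andP=> exy yp; have [/= -> ->] := IHp y yp.
by rewrite -(eQ _ _ exy) orbb andbb.
Qed.

Section SpecialMinOrdering.

Variables (W : finType) (H : sgraph W) (le : rel W).
Hypotheses (Hrefl : reflexive_sgraph H) (Hnored : no_red H).
Hypothesis Hle : special_min_ordering H le.

Let lexx : reflexive le. Proof. by case: Hle => [[[]]]. Qed.
Let le_anti : antisymmetric le. Proof. by case: Hle => [[[]]]. Qed.
Let le_total : total le. Proof. by case: Hle => [[[]]]. Qed.

Lemma nle_le u v : ~~ le u v -> le v u.
Proof. by have := le_total u v; case: (le u v). Qed.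

Lemma strictNge u v : strict le u v = ~~ le v u.
Proof.
rewrite /strict; apply/andP/idP => [[neq_uv le_uv]|nle_vu].
  by apply: contraNN neq_uv => le_vu; apply/eqP/le_anti; rewrite le_uv.
split; first by apply: contraNneq nle_vu => ->.
exact: nle_le.
Qed.

Lemma adj_sym u v : adj H u v = adj H v u.
Proof. by rewrite /adj pos_sym neg_sym. Qed.

Lemma bicoloured_sym u v : bicoloured H u v = bicoloured H v u.
Proof. by rewrite /bicoloured pos_sym neg_sym. Qed.

Lemma blue_sym u v : blue H u v = blue H v u.
Proof. by rewrite /blue pos_sym neg_sym. Qed.

Lemma blue_adj u v : blue H u v -> adj H u v.
Proof. by rewrite /blue /adj => /andP[->]. Qed.

Lemma bicoloured_adj u v : bicoloured H u v -> adj H u v.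
Proof. by rewrite /bicoloured /adj => /andP[->]. Qed.

Lemma adj_cases u v : adj H u v -> bicoloured H u v \/ blue H u v.
Proof.
have := Hnored u v; rewrite /adj /bicoloured /blue /red.
by case: (pos H u v); case: (neg H u v) => //; [left | right].
Qed.

Lemma bicoloured_blue_nle v a b :
  bicoloured H v a -> blue H v b -> ~~ le b a.
Proof.
move=> va vb; rewrite -strictNge; case: Hle => _; apply; first exact: va.
by rewrite /unicoloured vb.
Qed.

(** The min ordering property is applied to the edge [u v] and the loop at [w]. *)
Lemma adj_interval u w v : le u w -> le w v -> adj H u v -> adj H u w.
Proof.
move=> uw wv uv.
have [-> | neq_uw] := eqVneq u w; first exact: Hrefl.
have [-> // | neq_wv] := eqVneq w v.
have [[_ minH] _] := Hle.
by apply: (minH u v w w) => //; rewrite /strict ?neq_uw ?neq_wv.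
Qed.

Lemma bicoloured_loop_lower c v :
  bicoloured H c c -> le v c -> adj H v c -> bicoloured H v c.
Proof.
move=> cc vc /adj_cases[//|]; rewrite blue_sym => cv.
by have := bicoloured_blue_nle cc cv; rewrite vc.
Qed.

Lemma bicoloured_lower_loop u v :
  bicoloured H u v -> le u v -> bicoloured H u u.
Proof.
move=> uv leuv; have [//|uu] := adj_cases (Hrefl u).
by have := bicoloured_blue_nle uv uu; rewrite leuv.
Qed.

Definition before (c a : W) := le a c && ~~ adj H a c.

Lemma before_blue c a a' :
  bicoloured H c c -> blue H a a' -> before c a -> before c a'.
Proof.
move=> cc aa' /andP[leac nac].
(* Otherwise [c] lies between the adjacent [a] and [a'], so [a] is adjacent to [c]. *)
have lea'c : le a' c.
  apply: contraT => /nle_le leca'.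
  by rewrite (adj_interval leac leca' (blue_adj aa')) in nac.
rewrite /before lea'c; apply: contraT => /negbNE a'c.
(* An edge [a' c] would be bicoloured, so at [a'] the vertex [c] would precede the blue neighbour
   [a]. *)
have := bicoloured_blue_nle (bicoloured_loop_lower cc lea'c a'c).
by rewrite blue_sym in aa' => /(_ _ aa'); rewrite leac.
Qed.

Definition separated (a b : W) :=
  [exists c, [&& bicoloured H c c, le c b & before c a]].

Lemma separated_bicoloured a a' b b' :
  blue H a a' -> bicoloured H b b' -> le a b -> le a' b' -> le b b' ->
  separated a b.
Proof.
move=> aa' bb' leab lea'b' lebb'.
have bb := bicoloured_lower_loop bb' lebb'.
apply/existsP; exists b; rewrite bb lexx /before leab /=.
apply/negP => /(bicoloured_loop_lower bb leab) ab.
have leba' : le b a' := nle_le (bicoloured_blue_nle ab aa').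
(* The edge [b a'] can have no colour: bicoloured, it puts [b] before [a] at [a']; blue, it puts
   [b'] before [a'] at [b]. *)
have /adj_cases[] := adj_interval leba' lea'b' (bicoloured_adj bb').
  rewrite bicoloured_sym => a'b; rewrite blue_sym in aa'.
  by have := bicoloured_blue_nle a'b aa'; rewrite leab.
by move=> /(bicoloured_blue_nle bb'); rewrite lea'b'.
Qed.

Lemma separated_step a a' b b' :
  blue H a a' -> adj H b b' -> le a' b' -> separated a b -> separated a' b'.
Proof.
move=> aa' bb' lea'b' /existsP[c /and3P[cc lecb bca]].
have /andP[leac _] := bca.
have /andP[lea'c na'c] := before_blue cc aa' bca.
apply/existsP; case: (boolP (le c b')) => [lecb'|/nle_le leb'c].
  by exists c; rewrite cc lecb' /before lea'c.
(* Here [f'] has stepped below [c], and [c] lies between the adjacent [b'] and [b]. *)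
have adjb'c : adj H b' c.
  by apply: adj_interval leb'c lecb _; rewrite adj_sym.
have b'c := bicoloured_loop_lower cc leb'c adjb'c.
have b'b' := bicoloured_lower_loop b'c leb'c.
exists b'; rewrite b'b' lexx /before lea'b' /=.
apply/negP => /(bicoloured_loop_lower b'b' lea'b') a'b'.
have leb'a : le b' a.
  by apply/nle_le/(bicoloured_blue_nle a'b'); rewrite blue_sym.
(* Again no colour fits [b' a]: bicoloured, it puts [b'] before [a'] at [a]; blue, it puts [c]
   before [a] at [b']. *)
have /adj_cases[] := adj_interval leb'a leac adjb'c.
  rewrite bicoloured_sym => ab'.
  by have := bicoloured_blue_nle ab' aa'; rewrite lea'b'.
by move=> /(bicoloured_blue_nle b'c); rewrite leac.
Qed.

End SpecialMinOrdering.

Theorem theorem6 (W : finType) (H : sgraph W) (le : rel W)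
  (Hrefl : reflexive_sgraph H) (Hbal : weakly_balanced H) (Hnored : no_red H)
  (Hle : special_min_ordering H le)
  (V : Type) (G : sgraph V) (f f' : V -> W)
  (hf : sgraph_hom G H f) (hf' : sgraph_hom G H f')
  (hff' : forall v, le (f v) (f' v))
  (x : V) (p : seq V) (hC : closed_walk (adj G) x p)
  (hblue : all (fun uv => blue H uv.1 uv.2) (walk_edges (f x) (map f p)))
  (hbic : has (fun uv => bicoloured H uv.1 uv.2)
            (walk_edges (f' x) (map f' p))) :
  forall w : W, ~ (w \in map f (x :: p) /\ w \in map f' (x :: p)).
Proof.
pose e := [rel u v | relpre f' (adj H) u v && relpre f (blue H) u v].
have xp : path e x p.
  rewrite path_relI -!path_map -(all_walk_edges (blue H)) hblue andbT.
  by case: hC => + _; apply: homo_path => u v; case: hf' => + _ _; apply.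
pose sep v := separated H le (f v) (f' v).
have e_sep u v : e u v -> sep u = sep v.
  case/andP=> /= adjf' bluef; apply/idP/idP.
    exact: separated_step.
  by apply: separated_step; rewrite 1?blue_sym 1?adj_sym.
have some_sep : has sep (x :: p).
  apply: has_walk_edges_map xp hbic => u v /andP[_ /= bluef] bicf'.
  have [_ _ _ /(_ (f' u) (f' v)) /orP[leuv|levu]] := Hle.1.1; apply/orP.
    by left; apply: separated_bicoloured bluef bicf' _ _ leuv.
  right; rewrite blue_sym in bluef; rewrite bicoloured_sym in bicf'.
  exact: separated_bicoloured bluef bicf' _ _ levu.
have all_sep := path_invariant_all e_sep xp some_sep.
move=> w [wf /(nthP (f' x))[i]]; rewrite size_map => ltip.
rewrite (nth_map x) //; set v := nth x _ i => f'v.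
have /existsP[c /and3P[cc lecv bcv]] : sep v by apply: (all_nthP x all_sep).
(* With [c] now fixed, lying before [c] spreads from [f v] over the whole blue walk [f(C)], hence to
   [w]. *)
have /allP/(_ w wf) /andP[lewc] : all (before H le c) (map f (x :: p)).
  rewrite all_map; apply: path_invariant_all xp _ => [u u' /andP[_ /= uu']|].
    apply/idP/idP; apply: before_blue => //; by rewrite blue_sym.
  by apply/(has_nthP x); exists i.
have [_ le_anti _ _] := Hle.1.1.
(* As [c <= f' v = w <= c], the loop at [w] contradicts the non-adjacency in [before]. *)
have -> : w = c by apply: le_anti; rewrite lewc -f'v.
by rewrite Hrefl.
Qed.
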